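(* Let $X \subseteq \mathbb{C}^{n\times n}$ be an affine variety, let $Q \in \mathbb{C}^{n\times n}$, and let $r \geq 1$ be an integer. Assume that $\operatorname{rank}(\nabla_Q(M)) \leq r$ for each $M \in X$. Then, for every $A \in \mathbb{C}^{n\times n}$, $$\underline{\mathbf{FL}}_X(A) \geq \left\lceil \frac{\operatorname{rank}(\nabla_Q(A))}{r} \right\rceil.$$
   Context: For $P,Q \in \mathbb{C}^{n\times n}$, the displacement operator is $\nabla_{P,Q}:\mathbb{C}^{n\times n}\to\mathbb{C}^{n\times n}$, $A \mapsto PA - AQ$; write $\nabla_Q = \nabla_{Q,Q}$, so $\nabla_Q(A) = QA-AQ$. For an affine variety $X \subseteq \mathbb{C}^{n\times n}$ and an integer $k \geq 1$, let $\mu_k(X)$ be the Zariski closure in $\mathbb{C}^{n\times n}$ of $\{M_1\cdots M_k : M_1,\dots,M_k \in X\}$. The border $X$-factorization length of $A$ is $\underline{\mathbf{FL}}_X(A) = \min\{k \geq 1 : A \in \mu_k(X)\}$, with $\underline{\mathbf{FL}}_X(A) = \infty$ if $A \notin \mu_k(X)$ for all $k \geq 1$. *)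

(* Defs.v *)
From mathcomp Require Import all_boot all_order all_algebra.
From mathcomp Require Import boolp classical_sets reals constructive_ereal ereal.
From mathcomp Require Import complex.
From mathcomp Require mpoly.

Set Implicit Arguments.
Unset Strict Implicit.
Unset Printing Implicit Defensive.

Import Order.TTheory GRing.Theory Num.Theory.
Local Open Scope classical_set_scope.
Local Open Scope ring_scope.

Definition displacement (R : realType) (n : nat) (P Q A : 'M[R[i]]_n)
    : 'M[R[i]]_n :=
  P *m A - A *m Q.

Definition nabla (R : realType) (n : nat) (Q A : 'M[R[i]]_n) : 'M[R[i]]_n :=
  displacement Q Q A.

(* A polynomial function on n x n matrices is a polynomial in n * n variables
   evaluated at the entries of the matrix, enumerated by mxvec. *)
Definition mxeval (R : realType) (n : nat) (p : mpoly.mpoly (n * n)%N R[i])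
    (A : 'M[R[i]]_n) : R[i] :=
  mpoly.meval (fun j => mxvec A 0 j) p.

(* Varieties are not required to be irreducible or non-empty. *)
Definition affine_variety (R : realType) (n : nat) (X : set 'M[R[i]]_n)
    : Prop :=
  exists F : set (mpoly.mpoly (n * n)%N R[i]),
    X = [set A | forall p, F p -> mxeval p A = 0].

Definition zariski_closure (R : realType) (n : nat) (S : set 'M[R[i]]_n)
    : set 'M[R[i]]_n :=
  smallest (@affine_variety R n) S.

Definition mu (R : realType) (n k : nat) (X : set 'M[R[i]]_n)
    : set 'M[R[i]]_n :=
  zariski_closure
    [set \big[mulmx/1%:M]_(i < k) M i
      | M in [set M : 'I_k -> 'M[R[i]]_n | forall i, X (M i)]].

Definition border_FL (R : realType) (n : nat) (X : set 'M[R[i]]_n)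
    (A : 'M[R[i]]_n) : \bar R :=
  match pselect (exists k, (1 <= k)%N && `[< mu k X A >]) with
  | left ex => ((ex_minn ex)%:R)%:E
  | right _ => +oo%E
  end.

(* Main.v *)
Require Import Defs.
From mathcomp Require Import all_boot all_order all_algebra.
From mathcomp Require Import boolp classical_sets reals constructive_ereal ereal.
From mathcomp Require Import complex.
From mathcomp Require mpoly.
Import -(notations) mpoly.

Set Implicit Arguments.
Unset Strict Implicit.
Unset Printing Implicit Defensive.

Import Order.TTheory GRing.Theory Num.Theory.
Local Open Scope classical_set_scope.
Local Open Scope ring_scope.

(** The commutator [nabla Q] is a derivation, so [nabla Q (M_1 ... M_k)] is a
    sum of [k] terms, the [i]-th being [nabla Q (M_i)] multiplied on both sides
    by other matrices.  Each term has rank at most [r] when the [M_i] lie in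
    [X], hence products of [k] elements of [X] lie in the set of matrices [A]
    with [\rank (nabla Q A) <= k * r] ([rank_nabla_prod_le]).

    This bound survives Zariski closure because that set is itself an affine
    variety ([affine_variety_rank_nabla_le]): the entries of [nabla Q A] are
    linear in those of [A], and a rank bound amounts to the vanishing of
    determinants ([rank_leP]).  Therefore [mu k X A] forces
    [\rank (nabla Q A) <= k * r] ([rank_nabla_mu_le]), which is the claim. *)

(** Compressions [U *m B *m V] generalize square submatrices.  Allowing
    arbitrary [U] and [V] lets the change of bases that puts [B] in the normal
    form [pid_mx (\rank B)] exhibit a nonzero determinant directly, with no
    selection of independent rows and columns. *)
Lemma rank_leP (F : fieldType) (p q m : nat) (B : 'M[F]_(p, q)) :
  (\rank B <= m)%N <->
  (forall (U : 'M[F]_(m.+1, p)) (V : 'M[F]_(q, m.+1)), \det (U *m B *m V) = 0).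
Proof.
split=> [rkB U V | det0].
  apply/eqP; apply: contraTT rkB => detN0; rewrite -ltnNge.
  have /mxrank_unit <- : U *m B *m V \in unitmx by rewrite unitmxE unitfE.
  exact: leq_trans (mxrankM_maxl _ _) (mxrankM_maxr _ _).
rewrite leqNgt; apply/negP => ltmB.
have := det0 (pid_mx m.+1 *m invmx (col_ebase B))
             (invmx (row_ebase B) *m pid_mx m.+1).
rewrite -{2}[B]mulmx_ebase !mulmxA mulmxKV ?col_ebase_unit //.
rewrite mulmxK ?row_ebase_unit //.
have ltmp := leq_trans ltmB (rank_leq_row B).
have ltmq := leq_trans ltmB (rank_leq_col B).
rewrite !mul_pid_mx (minn_idPl ltmB) (minn_idPr ltmp) minnn (minn_idPr ltmq).
by rewrite pid_mx_1 det1 => /eqP; rewrite oner_eq0.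
Qed.

Lemma rmorph_det_commutator (S T : comNzRingType) (f : {rmorphism S -> T})
    (p q : nat) (U : 'M_(p, q)) (Q A : 'M_q) (V : 'M_(q, p)) :
  f (\det (U *m (Q *m A - A *m Q) *m V)) =
  \det (map_mx f U *m (map_mx f Q *m map_mx f A - map_mx f A *m map_mx f Q)
         *m map_mx f V).
Proof. by rewrite -det_map_mx !map_mxM map_mxB !map_mxM. Qed.

Section Nabla.

Variables (R : realType) (n : nat) (Q : 'M[R[i]]_n).

Lemma nablaM (A B : 'M[R[i]]_n) :
  nabla Q (A *m B) = nabla Q A *m B + A *m nabla Q B.
Proof.
by rewrite /nabla /displacement mulmxBl mulmxBr !mulmxA addrA subrK.
Qed.

Lemma nabla1 : nabla Q 1%:M = 0.
Proof. by rewrite /nabla /displacement mulmx1 mul1mx subrr. Qed.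

Lemma rank_nabla_prod_le (r k : nat) (M : 'I_k -> 'M[R[i]]_n) :
  (forall i, (\rank (nabla Q (M i)) <= r)%N) ->
  (\rank (nabla Q (\big[mulmx/1%:M]_(i < k) M i)) <= k * r)%N.
Proof.
elim: k M => [|k IHk] M rkM; first by rewrite big_ord0 nabla1 mxrank0.
rewrite big_ord_recl nablaM mulSn.
apply: leq_trans (mxrank_add _ _) (leq_add _ _).
  exact: leq_trans (mxrankM_maxl _ _) (rkM _).
by apply: leq_trans (mxrankM_maxr _ _) (IHk _ _).
Qed.

Let mp := mpoly.mpoly (n * n)%N R[i].

(** The matrix of coordinate functions; evaluating it at [A] gives back [A]. *)
Definition generic_mx : 'M[mp]_n := vec_mx (\row_j mpoly.mpolyX _ (mpoly.mnm1 j)).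

Lemma mxeval_generic (A : 'M[R[i]]_n) :
  map_mx (fun p : mp => mxeval p A) generic_mx = A.
Proof.
rewrite map_vec_mx -[RHS]mxvecK; congr vec_mx.
by apply/rowP=> j; rewrite !mxE /mxeval mpoly.mevalXU.
Qed.

Lemma mxeval_const (p q : nat) (A : 'M[R[i]]_n) (B : 'M[R[i]]_(p, q)) :
  map_mx (fun p : mp => mxeval p A) (map_mx (@mpoly.mpolyC (n * n) R[i]) B) = B.
Proof. by apply/matrixP=> i j; rewrite !mxE /mxeval mpoly.mevalC. Qed.

(** The defining equations are the determinants of [rank_leP] for
    [nabla Q A], read as polynomials in the entries of [A]. *)
Lemma affine_variety_rank_nabla_le (m : nat) :
  affine_variety [set A : 'M[R[i]]_n | (\rank (nabla Q A) <= m)%N].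
Proof.
pose C p q : 'M[R[i]]_(p, q) -> 'M[mp]_(p, q) := map_mx (@mpoly.mpolyC _ _).
pose minor (U : 'M_(m.+1, n)) (V : 'M_(n, m.+1)) : mp :=
  \det (C _ _ U *m (C _ _ Q *m generic_mx - generic_mx *m C _ _ Q) *m C _ _ V).
have minorE U V A : mxeval (minor U V) A = \det (U *m nabla Q A *m V).
  pose f : {rmorphism mp -> R[i]} := mpoly.meval (fun j => mxvec A 0 j).
  have fC p q (B : 'M_(p, q)) : map_mx f (C p q B) = B by exact: mxeval_const.
  have fX : map_mx f generic_mx = A by exact: mxeval_generic.
  by rewrite -[LHS]/(f (minor U V)) rmorph_det_commutator !fC fX.
exists [set p | exists U V, p = minor U V].
apply/seteqP; split=> A /=.
  by move=> /rank_leP det0 _ [U [V ->]]; rewrite minorE.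
by move=> eq0; apply/rank_leP => U V; rewrite -minorE; apply: eq0; exists U, V.
Qed.

Lemma rank_nabla_mu_le (X : set 'M[R[i]]_n) (r k : nat) (A : 'M[R[i]]_n) :
  (forall M, X M -> (\rank (nabla Q M) <= r)%N) ->
  mu k X A -> (\rank (nabla Q A) <= k * r)%N.
Proof.
move=> rkX /(_ [set B | (\rank (nabla Q B) <= k * r)%N]); apply.
split; first exact: affine_variety_rank_nabla_le.
by move=> _ [M XM <-]; apply: rank_nabla_prod_le => i; apply: rkX.
Qed.

End Nabla.

Theorem theorem4p17 (R : realType) (n : nat) (X : set 'M[R[i]]_n)
    (Q : 'M[R[i]]_n) (r : nat)
    (hX : affine_variety X)
    (hr : (1 <= r)%N)
    (hrank : forall M : 'M[R[i]]_n, X M -> (\rank (nabla Q M) <= r)%N)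
    (A : 'M[R[i]]_n) :
  (((Num.ceil ((\rank (nabla Q A))%:R / r%:R : R))%:~R : R)%:E
     <= border_FL X A)%E.
Proof.
rewrite /border_FL; case: pselect => [ex|_]; last exact: leey.
case: ex_minnP => k /andP[_ /asboolP muA] _.
rewrite lee_fin -[k%:R]/(k%:Z%:~R) ler_int ceil_le_int.
rewrite ler_pdivrMr ?ltr0n // -[k%:Z%:~R]/(k%:R) -natrM ler_nat.
exact: rank_nabla_mu_le hrank muA.
Qed.
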